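(* Let $n \ge 3$ be an integer. Let $m^*$ denote the maximum integer $m$ such that an equidistant code $E(n,d,m)$ exists for some $d$, and let $d^*$ denote the maximum $d$ such that an $E(n,d,m^* )$ exists. If $n \equiv 3 \pmod 4$, then $d^* \le (n+1)/2$. If $n \equiv r \pmod 4$, where $r \in \{0,1,2\}$, then $d^* \le (n-r)/2$.
   Context: An equidistant code $E(n,d,m)$ is a set of $m$ distinct binary codewords of length $n$ (elements of $\{0,1\}^n$) such that the Hamming distance between any two distinct codewords is exactly $d$. *)

(* Defs.v *)
From mathcomp Require Import all_boot.

Set Implicit Arguments.
Unset Strict Implicit.
Unset Printing Implicit Defensive.

Definition hamming_dist (n : nat) (x y : n.-tuple bool) : nat :=
  #|[set i : 'I_n | tnth x i != tnth y i]|.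

(* E(n,d,m): the codewords form a set, so they are distinct.  If m <= 1 the
   condition on distances is vacuous and every d is allowed. *)
Definition equidistant_code (n d m : nat) (C : {set n.-tuple bool}) : Prop :=
  #|C| = m /\ {in C &, forall x y, x != y -> hamming_dist x y = d}.

Definition equidistant_code_exists (n d m : nat) : Prop :=
  exists C : {set n.-tuple bool}, equidistant_code d m C.

Definition is_maximum (P : nat -> Prop) (k : nat) : Prop :=
  P k /\ forall j : nat, P j -> j <= k.

(* Main.v *)
Require Import Defs.
From mathcomp Require Import all_boot.
From mathcomp Require Import zify.

(** Write [m] for the largest size of an equidistant code of length [n], and let
    [d] be a distance at which this size is attained.  Three facts suffice.

    - [m >= n], since the [n] unit vectors are pairwise at distance 2.
    - Plotkin's averaging bound [2 * d * (m - 1) <= n * m]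
      ([equidistant_plotkin]): a single coordinate separates at most half of the
      [m ^ 2] ordered pairs of codewords.  When [m >= n >= 3], this forces
      [2 * d <= n + 1].
    - [d] is even as soon as there are three codewords
      ([equidistant_even]): the distance of two words has the parity of the sum
      of their weights, so among three words the distances sum to an even
      number, here [3 * d].

    An even [d] with [2 * d <= n + 1] is at most twice the integer part of
    [(n + 1) / 4], which is the claimed value in each residue class of [n]
    modulo 4. *)

Set Implicit Arguments.
Unset Strict Implicit.
Unset Printing Implicit Defensive.

Lemma hamming_distE n (x y : n.-tuple bool) :
  hamming_dist x y = \sum_(i < n) (tnth x i != tnth y i).
Proof. by rewrite /hamming_dist cardsE -sum1_card big_mkcond. Qed.

Lemma hamming_distxx n (x : n.-tuple bool) : hamming_dist x x = 0.
Proof. by rewrite hamming_distE big1 // => i _; rewrite eqxx. Qed.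

(** On booleans, being different is addition modulo 2, so the parity of the
    distance is additive along a path of words. *)
Lemma odd_hamming_dist_trans n (y x z : n.-tuple bool) :
  odd (hamming_dist x z) = odd (hamming_dist x y) (+) odd (hamming_dist y z).
Proof.
rewrite !hamming_distE !(big_morph odd oddD (erefl _)) -big_split /=.
by apply: eq_bigr => i _; case: (tnth x i) (tnth y i) (tnth z i) => [] [] [].
Qed.

Lemma equidistant_even n d m (C : {set n.-tuple bool}) :
  equidistant_code d m C -> 2 < m -> ~~ odd d.
Proof.
move=> [<- dC] /card_gt2P[x [y [z [[Cx Cy Cz] [xy yz zx]]]]].
have := odd_hamming_dist_trans y x z.
by rewrite !dC // 1?eq_sym //; case: (odd d).
Qed.

(** If [a] of the words of [C] have a 1 in position [i], the left-hand side is
    [4 * a * (#|C| - a)], and the bound is the arithmetic-geometric mean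
    inequality for [a] and [#|C| - a]. *)
Lemma separated_pairs_bound n (C : {set n.-tuple bool}) (i : 'I_n) :
  2 * (\sum_(x in C) \sum_(y in C) (tnth x i != tnth y i)) <= #|C| ^ 2.
Proof.
set A := [set x in C | tnth x i]; set B := [set x in C | ~~ tnth x i].
have cardC : #|C| = #|A| + #|B|.
  rewrite -(cardsID [set x | tnth x i] C); congr (_ + _); apply: eq_card => x.
    by rewrite !inE.
  by rewrite !inE andbC.
have countE (b : bool) :
    \sum_(y in C) (b != tnth y i) = if b then #|B| else #|A|.
  case: b; rewrite -sum1_card [RHS]big_mkcond [LHS]big_mkcond;
    by apply: eq_bigr => y _; rewrite inE; case: (y \in C) (tnth y i) => [] [].
rewrite (eq_bigr (fun x => if tnth x i then #|B| else #|A|)); last first.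
  by move=> x _; rewrite countE.
rewrite (bigID (fun x => tnth x i)) /=.
rewrite (eq_bigr (fun=> #|B|)) => [|x /andP[_ ->] //].
rewrite [X in _ + X](eq_bigr (fun=> #|A|)) => [|x /andP[_ /negPf->] //].
have -> : \sum_(x in C | tnth x i) #|B| = #|A| * #|B|.
  by rewrite -sum_nat_const; apply: eq_bigl => x; rewrite inE.
have -> : \sum_(x in C | ~~ tnth x i) #|A| = #|B| * #|A|.
  by rewrite -sum_nat_const; apply: eq_bigl => x; rewrite inE.
by rewrite cardC (mulnC #|B|) addnn -mul2n mulnA; apply: (nat_AGM2 _ _).1.
Qed.

(** The Plotkin bound: both sides estimate the sum of the distances over all
    ordered pairs of codewords. *)
Lemma equidistant_plotkin n d m (C : {set n.-tuple bool}) :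
  equidistant_code d m C -> 0 < m -> 2 * (d * m.-1) <= n * m.
Proof.
move=> [cardC dC] m_gt0.
have sumE : \sum_(x in C) \sum_(y in C) hamming_dist x y = m * (m.-1 * d).
  rewrite -cardC -sum_nat_const; apply: eq_bigr => x Cx.
  rewrite (big_setD1 x) //= hamming_distxx add0n (cardsD1 x C) Cx /=.
  rewrite -sum_nat_const; apply: eq_bigr => y; rewrite !inE => /andP[yx Cy].
  by rewrite dC // eq_sym.
have sumC : \sum_(x in C) \sum_(y in C) hamming_dist x y
    = \sum_(i < n) \sum_(x in C) \sum_(y in C) (tnth x i != tnth y i).
  rewrite [RHS]exchange_big; apply: eq_bigr => x _.
  by rewrite [RHS]exchange_big; apply: eq_bigr => y _; rewrite hamming_distE.
have : 2 * (m * (m.-1 * d)) <= n * m ^ 2.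
  rewrite -sumE sumC big_distrr /= -[X in _ <= X * _]card_ord -sum_nat_const.
  by apply: leq_sum => i _; rewrite -cardC separated_pairs_bound.
rewrite -(leq_pmul2l m_gt0); nia.
Qed.

Definition unit_word n (i : 'I_n) : n.-tuple bool := mktuple (fun j => j == i).

Lemma unit_word_inj n : injective (@unit_word n).
Proof.
by move=> i j /(congr1 (fun x => tnth x i)); rewrite !tnth_mktuple eqxx => /esym/eqP.
Qed.

Lemma hamming_dist_unit_word n (i j : 'I_n) :
  i != j -> hamming_dist (unit_word i) (unit_word j) = 2.
Proof.
move=> ij; rewrite /hamming_dist -[RHS]/(true.+1) -ij -cards2.
apply: eq_card => k; rewrite !inE !tnth_mktuple.
by have [->|] := eqVneq k i; [rewrite (negPf ij) | case: (k == j)].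
Qed.

Lemma unit_code_exists n : equidistant_code_exists n 2 n.
Proof.
exists [set unit_word i | i : 'I_n]; split.
  by rewrite card_imset ?card_ord //; apply: unit_word_inj.
move=> _ _ /imsetP[i _ ->] /imsetP[j _ ->] ij.
by apply: hamming_dist_unit_word; apply: contraNneq ij => ->.
Qed.

Theorem theorem1p2 (n mstar dstar : nat)
  (hn : 3 <= n)
  (hm : is_maximum (fun m => exists d : nat, equidistant_code_exists n d m) mstar)
  (hd : is_maximum (fun d => equidistant_code_exists n d mstar) dstar) :
  (n = 3 %[mod 4] -> dstar <= (n + 1) %/ 2) /\
  (forall r : nat, r \in [:: 0; 1; 2] -> n = r %[mod 4] ->
     dstar <= (n - r) %/ 2).
Proof.
have le_n_m : n <= mstar by apply: hm.2; exists 2; apply: unit_code_exists.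
have [C codeC] := hd.1.
have d_even : ~~ odd dstar by apply: equidistant_even codeC _; lia.
have d_small : 2 * dstar <= n + 1.
  have := equidistant_plotkin codeC; rewrite leqNgt.
  move=> /(_ ltac:(lia)) plotkin; apply/negP => d_large.
  (* [n + 2 <= 2 * dstar] gives [(n + 2) * (mstar - 1) <= n * mstar], i.e.
     [2 * mstar <= n + 2], against [mstar >= n >= 3]. *)
  have : (n + 2) * mstar.-1 <= 2 * dstar * mstar.-1 by apply: leq_mul; lia.
  nia.
split=> [|r r012] nr; first by lia.
by move: r012 nr; rewrite !inE => /or3P[] /eqP->; lia.
Qed.
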